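(* Let $G$ be an OD-admissible graph. (a) If $G$ is the disjoint union of a graph $G'$ and an isolated vertex, then $\gamma^{\rm OD}(G) = \gamma^{\rm OTD}(G') + 1$. (b) If $G$ is OTD-admissible, then $\gamma^{\rm OTD}(G) - 1 \leq \gamma^{\rm OD}(G) \leq \gamma^{\rm OTD}(G)$.
   Context: Graphs are finite, simple and undirected. For a vertex $v$ of $G=(V,E)$, $N(v)=\{u\in V: uv\in E\}$ and $N[v]=N(v)\cup\{v\}$. A set $C\subseteq V$ is dominating if $N[v]\cap C\neq\emptyset$ for all $v\in V$; total-dominating if $N(v)\cap C\neq\emptyset$ for all $v\in V$; open-separating if $N(u)\cap C\neq N(v)\cap C$ for all distinct $u,v\in V$. An OD-code of $G$ is a set that is dominating and open-separating; an OTD-code of $G$ is a set that is total-dominating and open-separating. For $X\in\{\mathrm{OD},\mathrm{OTD}\}$, $G$ is X-admissible if it has an X-code, and then $\gamma^{\rm X}(G)$ denotes the minimum cardinality of an X-code of $G$. An isolated vertex is a vertex $v$ with $N(v)=\emptyset$. *)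

(* Defs.v *)
From mathcomp Require Import all_boot.

Set Implicit Arguments.
Unset Strict Implicit.
Unset Printing Implicit Defensive.

Record sgraph := SGraph {
  svertex :> finType;
  sedge : rel svertex;
  sedge_sym : symmetric sedge;
  sedge_irr : irreflexive sedge
}.

Section Codes.
Variable G : sgraph.
Implicit Types (C : {set G}) (v : G).

Definition nbh v : {set G} := [set u | sedge u v].
Definition cnbh v : {set G} := v |: nbh v.

Definition dominating C : bool := [forall v, cnbh v :&: C != set0].
Definition total_dominating C : bool := [forall v, nbh v :&: C != set0].
Definition open_separating C : bool :=
  [forall u, forall v, (u != v) ==> (nbh u :&: C != nbh v :&: C)].

Definition od_code C : bool := dominating C && open_separating C.
Definition otd_code C : bool := total_dominating C && open_separating C.

Definition od_admissible : bool := [exists C, od_code C].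
Definition otd_admissible : bool := [exists C, otd_code C].

(* As soon as some code exists, [arg min] is a code of minimum cardinality,
   whether or not the default set0 is a code; without any code the value is
   the meaningless #|set0| = 0. *)
Definition gamma_od : nat := #|[arg min_(C < set0 | od_code C) #|C|]|.
Definition gamma_otd : nat := #|[arg min_(C < set0 | otd_code C) #|C|]|.

End Codes.

Definition sg_iso (G H : sgraph) : Prop :=
  exists2 f : G -> H, bijective f & {mono f : u v / sedge u v}.

Section DisjointUnion.
Variables G H : sgraph.

Definition dunion_edge (x y : G + H) : bool :=
  match x, y with
  | inl u, inl v => sedge u v
  | inr u, inr v => sedge u v
  | _, _ => false
  end.

Lemma dunion_sym : symmetric dunion_edge.
Proof. by move=> [u|u] [v|v] //=; rewrite sedge_sym. Qed.

Lemma dunion_irr : irreflexive dunion_edge.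
Proof. by move=> [u|u] /=; rewrite sedge_irr. Qed.

Definition dunion : sgraph := SGraph dunion_sym dunion_irr.

End DisjointUnion.

Definition one_vertex_graph : sgraph :=
  @SGraph unit (fun _ _ => false) (fun _ _ => erefl) (fun _ => erefl).

(* Main.v *)
(** In an open-separating set C at most one vertex v has no neighbour in C.
    For OD-codes of G' + K_1 the isolated vertex is this exception, and it must
    belong to C in order to be dominated; hence OD-codes of G' + K_1 are exactly
    the OTD-codes of G' together with the isolated vertex.  In general, adding to
    an OD-code one neighbour of the exceptional vertex makes it an OTD-code, since
    supersets of open-separating sets are open-separating. *)
Require Import Defs.
From mathcomp Require Import all_boot.

(** [arg_minnP] wants a default satisfying [P], which [D] may fail. With [C0] as default it yields a
    minimal set, so the search inside [arg min] cannot fall back on [D]. *)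
Lemma arg_min_card (T : finType) (P : pred {set T}) (D C0 : {set T}) :
  P C0 ->
  P [arg min_(C < D | P C) #|C|] /\
  (forall C, P C -> #|[arg min_(C < D | P C) #|C|]| <= #|C|).
Proof.
move=> PC0; rewrite /arg_min /extremum.
case: pickP => [A /andP[PA /forallP minA]|none] /=.
  by split=> // C PC; have := minA C; rewrite PC.
case: (arg_minnP (fun C : {set T} => #|C|) PC0) => A PA minA.
have /negP[] := negbT (none A); rewrite /= PA /=.
by apply/forallP => C; apply/implyP; apply: minA.
Qed.

Section Codes.
Variable G : sgraph.
Implicit Types (C D : {set G}) (u v : G).

Lemma dominatingP C :
  reflect (forall v, exists2 x, (x == v) || sedge v x & x \in C) (dominating C).
Proof.
apply: (iffP forallP) => domC v.
  by have /set0Pn[x] := domC v; rewrite !inE sedge_sym => /andP[vx Cx]; exists x.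
by have [x vx Cx] := domC v; apply/set0Pn; exists x; rewrite !inE sedge_sym vx.
Qed.

Lemma total_dominatingP C :
  reflect (forall v, exists2 x, sedge v x & x \in C) (total_dominating C).
Proof.
apply: (iffP forallP) => domC v.
  by have /set0Pn[x] := domC v; rewrite !inE sedge_sym => /andP[vx Cx]; exists x.
by have [x vx Cx] := domC v; apply/set0Pn; exists x; rewrite !inE sedge_sym vx.
Qed.

Lemma open_separatingP C :
  reflect (forall u v, {in C, sedge u =1 sedge v} -> u = v) (open_separating C).
Proof.
apply: (iffP forallP) => sepC u; last first.
  apply/forallP => v; apply/implyP; apply: contra => /eqP eqN.
  apply/eqP/sepC => x Cx; have /setP/(_ x) := eqN.
  by rewrite !inE Cx !andbT ![sedge x _]sedge_sym.
move=> v eqN; apply/eqP; have /forallP/(_ v) := sepC u.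
apply: contraLR => neq_uv; rewrite neq_uv /= negbK.
apply/eqP/setP => x; rewrite !inE ![sedge x _]sedge_sym.
by apply/andb_id2r/eqN.
Qed.

Lemma open_separatingS C D :
  C \subset D -> open_separating C -> open_separating D.
Proof.
move=> /subsetP sCD /open_separatingP sepC; apply/open_separatingP => u v eqN.
by apply: sepC => x /sCD; apply: eqN.
Qed.

(** If [u] also had no neighbour in [C], both traces on [C] would be empty and hence equal. *)
Lemma open_separating_undominated C u v :
  open_separating C -> {in C, forall x, ~~ sedge v x} -> u != v ->
  exists2 x, sedge u x & x \in C.
Proof.
move=> /open_separatingP sepC Nv neq_uv; apply/exists_inP.
apply: contraNT neq_uv => /exists_inPn Nu; apply/eqP/sepC => x Cx.
by rewrite (negPf (Nv x Cx)); apply/negP => /Nu; rewrite Cx.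
Qed.

Lemma otd_code_od C : otd_code C -> od_code C.
Proof.
case/andP=> /total_dominatingP domC sepC; rewrite /od_code sepC andbT.
apply/dominatingP => v; have [x vx Cx] := domC v.
by exists x; rewrite // vx orbT.
Qed.

Lemma open_separating_extend C :
  otd_admissible G -> open_separating C ->
  exists2 D : {set G}, otd_code D & #|D| <= #|C| + 1.
Proof.
move=> /existsP[A /andP[/total_dominatingP domA _]] sepC.
have [domC|/forallPn[v]] := boolP (total_dominating C).
  by exists C; rewrite ?leq_addr // /otd_code domC.
(* Admissibility enters here: the OTD-code [A] shows that [v] is not isolated, and [w] is the vertex
   to add. *)
rewrite negbK => /eqP/setP Nv; have [w vw _] := domA v.
have {}Nv : {in C, forall x, ~~ sedge v x}.
  by move=> x Cx; have := Nv x; rewrite !inE Cx andbT sedge_sym => ->.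
exists (w |: C); last by rewrite cardsU1 addnC leq_add2l leq_b1.
apply/andP; split; last exact: open_separatingS (subsetUr _ _) sepC.
apply/total_dominatingP => u; have [->|neq_uv] := eqVneq u v.
  by exists w; rewrite // setU11.
have [x ux Cx] := open_separating_undominated _ _ _ sepC Nv neq_uv.
by exists x; rewrite // setU1r.
Qed.

Lemma gamma_odP :
  od_admissible G ->
  (exists2 C : {set G}, od_code C & #|C| = gamma_od G) /\
  (forall C, od_code C -> gamma_od G <= #|C|).
Proof.
case/existsP=> C0 /(arg_min_card _ (@od_code G) set0 C0)[odC minC]; split=> //.
by eexists; first exact: odC.
Qed.

Lemma gamma_otdP :
  otd_admissible G ->
  (exists2 C : {set G}, otd_code C & #|C| = gamma_otd G) /\
  (forall C, otd_code C -> gamma_otd G <= #|C|).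
Proof.
case/existsP=> C0 /(arg_min_card _ (@otd_code G) set0 C0)[odC minC]; split=> //.
by eexists; first exact: odC.
Qed.

End Codes.

Section IsolatedVertex.
(** The decomposition is kept abstract: [h] embeds [G'] onto all vertices but [z], so no argument
    below has to handle the sum type. *)
Variables (G G' : sgraph) (h : G' -> G) (z : G).
Hypotheses (h_inj : injective h) (h_mono : {mono h : u v / sedge u v}).
Hypotheses (z_isolated : forall v, sedge z v = false) (h_neq : forall u, h u != z).
Hypothesis h_cover : forall v, v = z \/ exists u, v = h u.

Lemma od_code_delete_isolated (C : {set G}) :
  od_code C -> otd_code (h @^-1: C) /\ #|C| = #|h @^-1: C| + 1.
Proof.
case/andP=> /dominatingP domC sepC.
have Cz : z \in C by have [x] := domC z; rewrite z_isolated orbF => /eqP->.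
split; last first.
  rewrite (cardsD1 z) Cz addnC -(card_imset (h @^-1: C) h_inj); congr (#|pred_of_set _| + 1).
  apply/setP => v; rewrite !inE; have [->|[u ->]] := h_cover v.
    rewrite eqxx; apply/esym/negbTE/imsetP => -[u _ /eqP].
    by rewrite eq_sym (negPf (h_neq u)).
  by rewrite h_neq mem_imset // inE.
apply/andP; split.
  apply/total_dominatingP => u.
  (* As [z] is already the exceptional vertex, every [h u] has a neighbour in [C]. That neighbour is
     not the isolated [z], so it comes from [G']. *)
  have Nz : {in C, forall x, ~~ sedge z x} by move=> x _; rewrite z_isolated.
  have [x ux Cx] := open_separating_undominated _ _ _ _ sepC Nz (h_neq u).
  have [eq_xz|[y eq_xy]] := h_cover x.
    by move: ux; rewrite eq_xz sedge_sym z_isolated.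
  by exists y; rewrite -?h_mono ?inE -?eq_xy.
move/open_separatingP: sepC => sepC; apply/open_separatingP => u v eqN.
(* No vertex is adjacent to [z], so [z] separates nothing and only code vertices in the image of [h]
   matter. *)
apply/h_inj/sepC => x; have [->|[y ->]] := h_cover x.
  by rewrite ![sedge _ z]sedge_sym !z_isolated.
by move=> Cy; rewrite !h_mono eqN // inE.
Qed.

Lemma otd_code_add_isolated (C : {set G'}) :
  otd_code C -> od_code (z |: h @: C) /\ #|z |: h @: C| = #|C| + 1.
Proof.
case/andP=> /total_dominatingP domC /open_separatingP sepC; split; last first.
  have /negPf zC : z \notin h @: C.
    by apply/imsetP => -[u _ /eqP]; rewrite eq_sym (negPf (h_neq u)).
  by rewrite cardsU1 (card_imset _ h_inj) zC addnC.
have domh u : exists2 x, sedge (h u) x & x \in z |: h @: C.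
  have [x ux Cx] := domC u.
  by exists (h x); rewrite ?h_mono // setU1r // imset_f.
apply/andP; split.
  apply/dominatingP => v; have [->|[u ->]] := h_cover v.
    by exists z; rewrite ?eqxx // setU11.
  by have [x ux Cx] := domh u; exists x; rewrite // ux orbT.
apply/open_separatingP => v w.
have [->|[v' ->]] := h_cover v; have [->|[w' ->]] := h_cover w => // eqN.
(* Total domination in [G'] separates [z] from the rest: [h w'] has a neighbour in the code, [z] has
   none. *)
- by have [x ux /eqN] := domh w'; rewrite z_isolated ux.
- by have [x ux /eqN] := domh v'; rewrite z_isolated ux.
congr h; apply: sepC => x Cx.
by rewrite -!h_mono eqN // setU1r // imset_f.
Qed.

(** Admissibility of [G'] is part of the conclusion because without it [gamma_otd G'] would be the
    meaningless 0. *)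
Lemma gamma_od_isolated :
  od_admissible G -> otd_admissible G' /\ gamma_od G = gamma_otd G' + 1.
Proof.
case/gamma_odP=> -[C odC <-] minC.
have [otdC' ->] := od_code_delete_isolated _ odC.
have admG' : otd_admissible G' by apply/existsP; exists (h @^-1: C).
split=> //; have [[D otdD cardD] minD] := gamma_otdP _ admG'.
congr (_ + 1); apply/eqP; rewrite eqn_leq minD // andbT -cardD.
have [odD eqD] := otd_code_add_isolated _ otdD.
have [_ eqC] := od_code_delete_isolated _ odC.
by rewrite -(leq_add2r 1) -eqC -eqD; have := minC _ odD.
Qed.

End IsolatedVertex.

Theorem theorem3 (G : sgraph) (hG : od_admissible G) :
  (forall G' : sgraph, sg_iso G (dunion G' one_vertex_graph) ->
     otd_admissible G' /\ gamma_od G = gamma_otd G' + 1) /\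
  (otd_admissible G ->
     gamma_otd G - 1 <= gamma_od G /\ gamma_od G <= gamma_otd G).
Proof.
split=> [G' [f [g fK gK] f_mono]|admG].
  (* The inverse isomorphism [g] provides the embedding [g \o inl] and the isolated vertex
     [g (inr tt)]. *)
  have g_mono x y : sedge (g x) (g y) = sedge x y by rewrite -f_mono !gK.
  apply: (@gamma_od_isolated G G' (g \o inl) (g (inr tt))) => //.
  - by apply: inj_comp (can_inj gK) _ => u v [].
  - by move=> u v; rewrite /= g_mono.
  - by move=> v; rewrite -(fK v) g_mono; case: (f v).
  - by move=> u; rewrite /= (can_eq gK).
  - move=> v; rewrite -(fK v); case: (f v) => [u|[]]; last by left.
    by right; exists u.
have [[C odC <-] minC] := gamma_odP _ hG.
have [[D otdD eqD] minD] := gamma_otdP _ admG; rewrite -{2}eqD.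
split; last exact/minC/otd_code_od.
have /andP[_ sepC] := odC.
have [E otdE cardE] := open_separating_extend _ _ admG sepC.
(* Truncated subtraction is harmless: the bound is equivalent to [gamma_otd G <= #|C| + 1], which
   [E] witnesses. *)
by rewrite leq_subLR addnC (leq_trans _ cardE) // minD.
Qed.
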